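(* Let $r$ be continuous, let $f$ be a nontrivial real solution of $f''(x)+r(x)f(x)=0$, let $z_{f'_1}<z_{f'_2}$ be two consecutive zeros of $f'$, let $\mathcal{I}=(z_{f'_1},z_{f'_2})$, and let $z_{f_1}$ be the unique zero of $f$ in $\mathcal{I}$. Put $h=f/f'$ on $\mathcal I$. Suppose $r(x)>0$ for all $x\in\mathcal{I}$. For an initial guess $x_0\in\mathcal I$ consider the modified Halley iteration $$x_{n+1}=x_n-\frac{2h(x_n)}{2+r(x_0)h^2(x_n)},\qquad n=0,1,2,\dots$$ (1) If $r$ is non-increasing in $(z_{f'_1},z_{f_1})$, then for every initial guess $x_0\in(z_{f'_1},z_{f_1})$ the sequence $(x_n)$ is well defined and converges monotonically to $z_{f_1}$. (2) If $r$ is non-decreasing in $(z_{f_1},z_{f'_2})$, then for every initial guess $x_0\in(z_{f_1},z_{f'_2})$ the sequence $(x_n)$ is well defined and converges monotonically to $z_{f_1}$.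
   Context: All functions are real-valued; $r$ is continuous on an open interval $D\subseteq\mathbb{R}$ containing all points mentioned, and $f$ is a not identically zero solution on $D$ of $f''+rf=0$. It is a standing assumption that $f$ has exactly one zero $z_{f_1}$ in $\mathcal I=(z_{f'_1},z_{f'_2})$. Since $f'$ has no zeros in $\mathcal I$, the function $h=f/f'$ is defined on $\mathcal I$. ''Converges monotonically'' means that the sequence is monotone and converges. *)

(* Defs.v *)
From Stdlib Require Import Reals.
From Coquelicot Require Import Coquelicot.
Open Scope R_scope.

Definition Rbar_open_interval (a b : Rbar) (x : R) : Prop :=
  Rbar_lt a x /\ Rbar_lt x b.

(* [Derive] is total, so twice differentiability is required explicitly. *)
Definition is_solution (D : R -> Prop) (r f : R -> R) : Prop :=
  forall x, D x ->
    ex_derive f x /\ ex_derive (Derive f) x /\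
    Derive (Derive f) x + r x * f x = 0.

Definition nontrivial_on (D : R -> Prop) (f : R -> R) : Prop :=
  exists x, D x /\ f x <> 0.

Definition consecutive_zeros (g : R -> R) (a b : R) : Prop :=
  a < b /\ g a = 0 /\ g b = 0 /\ (forall x, a < x < b -> g x <> 0).

Definition unique_zero_in (g : R -> R) (a b z : R) : Prop :=
  (a < z < b /\ g z = 0) /\ (forall x, a < x < b -> g x = 0 -> x = z).

Definition non_increasing_in (g : R -> R) (a b : R) : Prop :=
  forall x y, a < x -> x <= y -> y < b -> g y <= g x.

Definition non_decreasing_in (g : R -> R) (a b : R) : Prop :=
  forall x y, a < x -> x <= y -> y < b -> g x <= g y.

(* Only meaningful where [Derive f x <> 0]. *)
Definition ratio (f : R -> R) (x : R) : R := f x / Derive f x.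

(* The coefficient [r x0] is frozen at the initial guess; only [ratio f]
   is re-evaluated at each iterate. *)
Fixpoint modified_halley (r f : R -> R) (x0 : R) (n : nat) : R :=
  match n with
  | O => x0
  | S m =>
      let x := modified_halley r f x0 m in
      x - 2 * ratio f x / (2 + r x0 * (ratio f x) ^ 2)
  end.

(* Division being total, well-definedness is made explicit: every iterate lies
   in the interval (a, b) on which f/f' is defined, and no denominator of the
   iteration vanishes. *)
Definition halley_well_defined (r f : R -> R) (a b x0 : R) : Prop :=
  forall n, let x := modified_halley r f x0 n in
    a < x < b /\ 2 + r x0 * (ratio f x) ^ 2 <> 0.

Definition converges_monotonically (u : nat -> R) (l : R) : Prop :=
  (Un_growing u \/ Un_decreasing u) /\ is_lim_seq u l.

(* Main.v *)
(** The ratio [h = f / f'] satisfies the Riccati equation [h' = 1 + r h^2]. If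
    [R] bounds [r] between the initial guess and the zero [z], the step
    [phi x = x - 2 h / (2 + R h^2)] satisfies
    [phi' = ((6 R - 4 r) h^2 + (R^2 + 2 r R) h^4) / (2 + R h^2)^2],
    which is positive between the guess and [z], where [h] does not vanish.
    As [phi z = z], the iterates cannot jump over [z]; the sign of [h] makes them
    monotone, and the limit is a fixed point of [phi], hence a zero of [h].
    The right-hand side follows by the reflection [x |-> - x]. *)
Require Import Defs.
From Stdlib Require Import Reals Lra.
From Coquelicot Require Import Coquelicot.
Open Scope R_scope.

Definition halley_step (h : R -> R) (q x : R) : R :=
  x - 2 * h x / (2 + q * h x ^ 2).

Lemma halley_denominator_pos (q y : R) : 0 <= q -> 0 < 2 + q * y ^ 2.
Proof. intros Hq; generalize (pow2_ge_0 y); nra. Qed.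

(** The quotient rule gives [1 - 2 h' (2 - q h^2) / (2 + q h^2)^2]; substituting [h' = 1 + p h^2],
    the constant terms of the numerator cancel. *)
Lemma is_derive_halley_step (h : R -> R) (q p x : R) :
  0 <= q -> is_derive h x (1 + p * h x ^ 2) ->
  is_derive (halley_step h q) x
    (((6 * q - 4 * p) * h x ^ 2 + (q ^ 2 + 2 * p * q) * h x ^ 4)
     / (2 + q * h x ^ 2) ^ 2).
Proof.
intros Hq Hh.
assert (Hd := halley_denominator_pos q (h x) Hq).
unfold halley_step; auto_derive.
- assert (He : ex_derive h x) by (now exists (1 + p * h x ^ 2)).
  simpl in Hd; repeat split; try exact He; lra.
- replace (Derive (fun x0 => h x0) x) with (1 + p * h x ^ 2)
    by (symmetry; now apply is_derive_unique).
  field; simpl in Hd; lra.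
Qed.

Lemma is_derive_pos_lt (g dg : R -> R) (x y : R) :
  x < y -> (forall c, x <= c <= y -> is_derive g c (dg c)) ->
  (forall c, x < c < y -> 0 < dg c) -> g x < g y.
Proof.
intros Hxy Hg Hpos.
destruct (MVT_cor2 g dg x y Hxy) as [c [Hc Hcxy]].
{ intros c Hc; apply is_derive_Reals; now apply Hg. }
specialize (Hpos c Hcxy); nra.
Qed.

Section LeftOfZero.

(** Only the Riccati equation and a bound on its coefficient are kept, with no mention of [f], so
    that the section applies both to [ratio f] and to its reflection. *)
Variables (rho h : R -> R) (q x0 z : R) (u : nat -> R).
Hypotheses (x0_lt_z : x0 < z) (q_pos : 0 < q).
Hypothesis riccati :
  forall x, x0 <= x <= z -> is_derive h x (1 + rho x * h x ^ 2).
Hypothesis hz : h z = 0.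
(** The point [z] is left out because [r] is assumed monotone only on the open interval ending at
    the zero. *)
Hypothesis rho_bounds : forall x, x0 <= x < z -> 0 <= rho x <= q.
Hypotheses (u_0 : u 0%nat = x0) (u_S : forall n, u (S n) = halley_step h q (u n)).

(** As [rho] is nonnegative, [h' >= 1], so [h] increases strictly up to its zero at [z]. *)
Lemma riccati_neg (x : R) : x0 <= x < z -> h x < 0.
Proof.
intros Hx; rewrite <- hz.
apply (is_derive_pos_lt h (fun c => 1 + rho c * h c ^ 2)); [lra | |].
- intros c Hc; apply riccati; lra.
- intros c Hc; destruct (rho_bounds c ltac:(lra)).
  generalize (pow2_ge_0 (h c)); nra.
Qed.

Lemma halley_step_lt_zero (x : R) : x0 <= x < z -> halley_step h q x < z.
Proof.
intros Hx.
apply Rlt_le_trans with (halley_step h q z);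
  [|right; unfold halley_step; rewrite hz; field; lra].
apply (is_derive_pos_lt _ (fun c =>
  ((6 * q - 4 * rho c) * h c ^ 2 + (q ^ 2 + 2 * rho c * q) * h c ^ 4)
   / (2 + q * h c ^ 2) ^ 2)); [lra | |].
- intros c Hc; apply is_derive_halley_step; [lra | apply riccati; lra].
- intros c Hc; destruct (rho_bounds c ltac:(lra)).
  assert (Hn := riccati_neg c ltac:(lra)).
  assert (0 < h c ^ 2) by nra.
  replace (h c ^ 4) with (h c ^ 2 * h c ^ 2) by ring.
  apply Rdiv_lt_0_compat; [|apply pow_lt, halley_denominator_pos; lra].
  (* Since [rho c <= q], the coefficient is at least [2 * q]. *)
  assert (0 < (6 * q - 4 * rho c) * h c ^ 2) by (apply Rmult_lt_0_compat; lra).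
  assert (0 <= (q ^ 2 + 2 * rho c * q) * (h c ^ 2 * h c ^ 2))
    by (apply Rmult_le_pos; nra).
  lra.
Qed.

Lemma halley_step_gt (x : R) : x0 <= x < z -> x < halley_step h q x.
Proof.
intros Hx; assert (Hn := riccati_neg x Hx).
assert (0 < 2 * - h x / (2 + q * h x ^ 2))
  by (apply Rdiv_lt_0_compat; [|apply halley_denominator_pos]; lra).
unfold halley_step; unfold Rdiv in *; lra.
Qed.

Lemma halley_bounds_left (n : nat) : x0 <= u n < z.
Proof.
induction n as [|n IH]; [rewrite u_0; lra|].
rewrite u_S; split; [|now apply halley_step_lt_zero].
generalize (halley_step_gt (u n) IH); lra.
Qed.

Lemma halley_growing_left : Un_growing u.
Proof.
intros n; rewrite u_S; apply Rlt_le, halley_step_gt, halley_bounds_left.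
Qed.

Lemma halley_lim_left : is_lim_seq u z.
Proof.
destruct (ex_finite_lim_seq_incr u z halley_growing_left) as [l Hl].
{ intros n; apply Rlt_le, halley_bounds_left. }
assert (Hlx : x0 <= l).
{ apply (is_lim_seq_le (fun _ => x0) u x0 l); [|apply is_lim_seq_const|exact Hl].
  intros n; apply halley_bounds_left. }
assert (Hlz : l <= z).
{ apply (is_lim_seq_le u (fun _ => z) l z); [|exact Hl|apply is_lim_seq_const].
  intros n; apply Rlt_le, halley_bounds_left. }
(* The shifted sequence tends both to [l] and, by continuity of the step, to [halley_step h q l]. *)
assert (Hfix : halley_step h q l = l).
{ assert (Hc : is_lim_seq (fun n => halley_step h q (u n)) (halley_step h q l)).
  { apply is_lim_seq_continuous; [|exact Hl].
    apply continuity_pt_filterlim, (ex_derive_continuous (halley_step h q)).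
    eexists; apply is_derive_halley_step; [lra | apply riccati; lra]. }
  assert (Hs := proj1 (is_lim_seq_incr_1 u l) Hl).
  apply is_lim_seq_unique in Hc.
  apply (is_lim_seq_ext _ (fun n => halley_step h q (u n)) _ u_S) in Hs.
  apply is_lim_seq_unique in Hs.
  rewrite Hs in Hc; now injection Hc. }
destruct (Req_dec l z) as [<- | Hne]; [exact Hl|].
(* A limit below [z] would be moved strictly to the right by the step, so it could not be fixed. *)
generalize (halley_step_gt l ltac:(lra)); lra.
Qed.

End LeftOfZero.

Lemma is_derive_ratio (f : R -> R) (r x : R) :
  ex_derive f x -> ex_derive (Derive f) x ->
  Derive (Derive f) x + r * f x = 0 -> Derive f x <> 0 ->
  is_derive (ratio f) x (1 + r * ratio f x ^ 2).
Proof.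
intros Hf Hf' Heq Hn.
replace (1 + r * ratio f x ^ 2)
  with ((Derive f x * Derive f x - f x * Derive (Derive f) x) / Derive f x ^ 2).
- apply (is_derive_div f (Derive f)); [now apply Derive_correct .. | exact Hn].
- replace (Derive (Derive f) x) with (- (r * f x)) by lra.
  unfold ratio; field; exact Hn.
Qed.

(** The two sign changes cancel in the derivative, so the point reflection of [h] satisfies the same
    Riccati equation with coefficient [r (- x)]. *)
Lemma is_derive_reflect (h : R -> R) (x l : R) :
  is_derive h (- x) l -> is_derive (fun y => - h (- y)) x l.
Proof.
intros Hh.
auto_derive; [now exists l|].
replace (Derive (fun y => h y) (- x)) with l
  by (symmetry; now apply is_derive_unique).
ring.
Qed.

Theorem theorem3p2 (a b : Rbar) (r f : R -> R) (zd1 zd2 z : R)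
  (hr : forall x, Rbar_open_interval a b x -> continuous r x)
  (hf : is_solution (Rbar_open_interval a b) r f)
  (hf0 : nontrivial_on (Rbar_open_interval a b) f)
  (hzd1 : Rbar_open_interval a b zd1) (hzd2 : Rbar_open_interval a b zd2)
  (hzd : consecutive_zeros (Derive f) zd1 zd2)
  (hz : unique_zero_in f zd1 zd2 z)
  (hpos : forall x, zd1 < x < zd2 -> 0 < r x) :
  (non_increasing_in r zd1 z ->
     forall x0, zd1 < x0 < z ->
       halley_well_defined r f zd1 zd2 x0 /\
       converges_monotonically (modified_halley r f x0) z)
  /\
  (non_decreasing_in r z zd2 ->
     forall x0, z < x0 < zd2 ->
       halley_well_defined r f zd1 zd2 x0 /\
       converges_monotonically (modified_halley r f x0) z).
Proof.
destruct hz as [[Hz fz] _], hzd as [_ [_ [_ Hf'n]]].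
assert (Hh : forall x, zd1 < x < zd2 ->
  is_derive (ratio f) x (1 + r x * ratio f x ^ 2)).
{ intros x Hx.
  destruct (hf x) as [H1 [H2 H3]]; [|now apply is_derive_ratio; auto].
  destruct hzd1 as [Ha _], hzd2 as [_ Hb]; split.
  - apply Rbar_lt_trans with zd1; [exact Ha | simpl; lra].
  - apply Rbar_lt_trans with zd2; [simpl; lra | exact Hb]. }
assert (hz0 : ratio f z = 0) by (unfold ratio; rewrite fz; apply Rdiv_0_l).
split; intros Hmono x0 Hx0; set (u := modified_halley r f x0);
  assert (Hq : 0 < r x0) by (apply hpos; lra).
- assert (Hder : forall x, x0 <= x <= z ->
    is_derive (ratio f) x (1 + r x * ratio f x ^ 2))
    by (intros x Hx; apply Hh; lra).
  assert (Hr : forall x, x0 <= x < z -> 0 <= r x <= r x0).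
  { intros x Hx; split; [apply Rlt_le, hpos | apply Hmono]; lra. }
  assert (HS : forall n, u (S n) = halley_step (ratio f) (r x0) (u n))
    by reflexivity.
  split; [|split; [left|]].
  + intros n.
    assert (Hb := halley_bounds_left r (ratio f) (r x0) x0 z u
                    ltac:(lra) Hq Hder hz0 Hr eq_refl HS n).
    fold u; cbv zeta; split; [lra|].
    apply Rgt_not_eq, halley_denominator_pos; lra.
  + apply (halley_growing_left r (ratio f) (r x0) x0 z); auto; lra.
  + apply (halley_lim_left r (ratio f) (r x0) x0); auto; lra.
- set (v := fun n => - u n).
  set (rho := fun x => r (- x)).
  set (h := fun x => - ratio f (- x)).
  assert (Hder : forall x, - x0 <= x <= - z ->
    is_derive h x (1 + rho x * h x ^ 2)).
  { intros x Hx; apply is_derive_reflect.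
    replace (h x ^ 2) with (ratio f (- x) ^ 2) by (unfold h; ring).
    apply Hh; lra. }
  (* Here [z < - x <= x0], so it is the non-decreasing [r] that is largest at the guess. *)
  assert (Hr : forall x, - x0 <= x < - z -> 0 <= rho x <= r x0).
  { intros x Hx; split; [apply Rlt_le, hpos | apply Hmono]; lra. }
  assert (Hz0 : h (- z) = 0) by (unfold h; rewrite Ropp_involutive, hz0; ring).
  (* The correction term is odd in [h], so reflection carries one iteration to the other with the
     same frozen coefficient [r x0]. *)
  assert (HS : forall n, v (S n) = halley_step h (r x0) (v n)).
  { intros n; unfold halley_step, h, v; rewrite Ropp_involutive.
    change (u (S n)) with (halley_step (ratio f) (r x0) (u n)).
    unfold halley_step; field.
    assert (Hd := halley_denominator_pos (r x0) (ratio f (u n)) ltac:(lra)).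
    simpl in Hd |- *; lra. }
  split; [|split; [right|]].
  + intros n.
    assert (Hb := halley_bounds_left rho h (r x0) (- x0) (- z) v
                    ltac:(lra) Hq Hder Hz0 Hr eq_refl HS n).
    fold u; cbv zeta; unfold v in Hb; split; [lra|].
    apply Rgt_not_eq, halley_denominator_pos; lra.
  + intros n.
    assert (Hg := halley_growing_left rho h (r x0) (- x0) (- z) v
                    ltac:(lra) Hq Hder Hz0 Hr eq_refl HS n).
    unfold v in Hg; lra.
  + assert (Hl := halley_lim_left rho h (r x0) (- x0) (- z) v
                    ltac:(lra) Hq Hder Hz0 Hr eq_refl HS).
    apply is_lim_seq_opp in Hl.
    apply (is_lim_seq_ext (fun n => - v n)); [intros n; apply Ropp_involutive|].
    simpl in Hl; now rewrite Ropp_involutive in Hl.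
Qed.
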